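(* Let $m,n,p\in\mathbb{N}$, let $\Sigma=(A,B,C)\in V_{m,n,p}$ be a linear control system, and let $V_\Sigma=(A,B_1,\ldots,B_m,C^1,\ldots,C^p)\in \mathrm{rep}_\alpha Q$ be the associated representation of dimension vector $\alpha=(1,n)$ of the quiver $Q$ described in the context. The following are equivalent: 1. $\Sigma$ is a canonical system; 2. $V_\Sigma$ is a simple representation of $Q$.
   Context: $V_{m,n,p}=M_n(\mathbb{C})\times M_{n\times m}(\mathbb{C})\times M_{p\times n}(\mathbb{C})$. A system $\Sigma=(A,B,C)\in V_{m,n,p}$ is completely controllable if $c(\Sigma)=[\,B\ AB\ \cdots\ A^{n-1}B\,]$ has maximal rank $n$, completely observable if the matrix $o(\Sigma)$ obtained by stacking $C,CA,\ldots,CA^{n-1}$ has maximal rank $n$, and canonical if it is both. $Q$ is the quiver with two vertices (left and right), $m$ arrows $b_1,\ldots,b_m$ from the left vertex to the right vertex, $p$ arrows $c_1,\ldots,c_p$ from the right vertex to the left vertex, and one loop at the right vertex. $\mathrm{rep}_\alpha Q$ is the space of complex representations of dimension vector $\alpha=(1,n)$ (dimension $1$ at the left vertex, $n$ at the right vertex). $V_\Sigma$ assigns to $b_i$ the $i$-th column $B_i$ of $B$, to $c_j$ the $j$-th row $C^j$ of $C$, and to the loop the matrix $A$; this identifies $V_{m,n,p}$ with $\mathrm{rep}_\alpha Q$. *)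

(* Defs.v *)
From mathcomp Require Import all_boot all_order all_algebra.
Set Implicit Arguments.
Unset Strict Implicit.
Unset Printing Implicit Defensive.
Import GRing.Theory.
Local Open Scope ring_scope.

Record linsys (F : fieldType) (m n p : nat) := LinSys {
  sysA : 'M[F]_n;
  sysB : 'M[F]_(n, m);
  sysC : 'M[F]_(p, n)
}.

Definition ctrb_mx (F : fieldType) (m n p : nat) (S : linsys F m n p) :=
  \mxrow_(k < n) (sysA S ^+ k *m sysB S).

Definition obsv_mx (F : fieldType) (m n p : nat) (S : linsys F m n p) :=
  \mxcol_(k < n) (sysC S *m sysA S ^+ k).

Definition completely_controllable (F : fieldType) (m n p : nat)
  (S : linsys F m n p) : Prop := \rank (ctrb_mx S) = n.

Definition completely_observable (F : fieldType) (m n p : nat)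
  (S : linsys F m n p) : Prop := \rank (obsv_mx S) = n.

Definition canonical_system (F : fieldType) (m n p : nat)
  (S : linsys F m n p) : Prop :=
  completely_controllable S /\ completely_observable S.

Record quiver := Quiver {
  vertex : finType;
  arrow : finType;
  source : arrow -> vertex;
  target : arrow -> vertex
}.

(* The space rep_alpha Q: vertex v carries the space of column vectors of size
   alpha v, on which the matrix of an arrow acts by left multiplication. *)
Definition rep (F : fieldType) (Q : quiver) (alpha : vertex Q -> nat) : Type :=
  forall a : arrow Q, 'M[F]_(alpha (target a), alpha (source a)).

Definition is_subrep (F : fieldType) (Q : quiver) (alpha : vertex Q -> nat)
    (V : rep F alpha) (W : forall v : vertex Q, {vspace 'cV[F]_(alpha v)})
    : Prop :=
  forall (a : arrow Q) (x : 'cV[F]_(alpha (source a))),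
    x \in W (source a) -> V a *m x \in W (target a).

(* The first conjunct says that V is nonzero. *)
Definition simple_rep (F : fieldType) (Q : quiver) (alpha : vertex Q -> nat)
    (V : rep F alpha) : Prop :=
  (exists v : vertex Q, alpha v <> 0%N) /\
  (forall W : forall v : vertex Q, {vspace 'cV[F]_(alpha v)},
     is_subrep V W ->
     (forall v : vertex Q, W v = 0%VS) \/
     (forall v : vertex Q, W v = fullv)).

Definition left_vertex : bool := false.
Definition right_vertex : bool := true.

(* The summands of the arrow type are the b_i, the c_j and the loop. *)
Definition sys_arrow (m p : nat) : finType := ('I_m + 'I_p + unit)%type.

Definition sys_source (m p : nat) (a : sys_arrow m p) : bool :=
  match a with
  | inl (inl _) => left_vertex
  | inl (inr _) => right_vertex
  | inr _ => right_vertex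
  end.

Definition sys_target (m p : nat) (a : sys_arrow m p) : bool :=
  match a with
  | inl (inl _) => right_vertex
  | inl (inr _) => left_vertex
  | inr _ => right_vertex
  end.

Definition sys_quiver (m p : nat) : quiver :=
  Quiver (@sys_source m p) (@sys_target m p).

Definition sys_dim (m n p : nat) (v : vertex (sys_quiver m p)) : nat :=
  if v == right_vertex then n else 1%N.

Definition sys_rep (F : fieldType) (m n p : nat) (S : linsys F m n p) :
    rep F (@sys_dim m n p) :=
  fun a =>
    match a return 'M[F]_(sys_dim n (sys_target a), sys_dim n (sys_source a)) with
    | inl (inl i) => col i (sysB S)
    | inl (inr j) => row j (sysC S)
    | inr _ => sysA S
    end.

(* Main.v *)
Require Import Defs.
From mathcomp Require Import all_boot all_order all_algebra.
From mathcomp Require Import reals complex.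
Set Implicit Arguments.
Unset Strict Implicit.
Unset Printing Implicit Defensive.
Import GRing.Theory.
Local Open Scope ring_scope.

(** The dimension vector is 1 at the left vertex, so a subrepresentation W is
    governed by whether its left component is everything or zero.

    If it is everything, the right component is stable under A and contains the
    columns of B, hence contains the reachable subspace, the column space of the
    controllability matrix; and the reachable subspace, together with the full
    left component, is itself a subrepresentation.  If it is zero, the right
    component is stable under A and killed by C, hence lies in the unobservable
    subspace, the kernel of the observability matrix; and the unobservable
    subspace, together with the zero left component, is itself a
    subrepresentation.

    So the representation is simple exactly when the reachable subspace is full
    ([reachable_full]) and the unobservable subspace is zero ([unobservable_eq0]).
    The extremality of the two subspaces is [reachable_min] and
    [unobservable_max].  Their stability under A, [reachable_stable] and
    [unobservable_stable], is where the truncation at the exponent n - 1 matters: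
    by Cayley-Hamilton (in the form of [expmx_dim]) the power A^n adds nothing
    new. *)

(** At size 0 the identity A ^+ 0 = 0 holds because all matrices are equal; this
    case is what makes the later lemmas uniform in n. *)
Lemma expmx_dim (F : fieldType) (n : nat) (A : 'M[F]_n) :
  exists c : 'I_n -> F, A ^+ n = \sum_(k < n) c k *: A ^+ k.
Proof.
case: n A => [|n] A.
  by exists (fun=> 0); apply/matrixP => -[].
exists (fun k => - (char_poly A)`_k).
have := Cayley_Hamilton A.
rewrite -[X in horner_mx A X]coefK poly_def size_char_poly raddf_sum.
rewrite big_ord_recr /=.
have lead1 : (char_poly A)`_n.+1 = 1.
  by have /monicP := char_poly_monic A; rewrite lead_coefE size_char_poly.
rewrite lead1 scale1r rmorphXn /= horner_mx_X => /eqP.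
rewrite addrC addr_eq0 => /eqP ->.
rewrite -sumrN; apply: eq_bigr => k _.
by rewrite linearZ rmorphXn /= horner_mx_X scaleNr.
Qed.

Section Subspaces.

Variables (F : fieldType) (m n p : nat) (S : linsys F m n p).
Local Notation A := (sysA S).
Local Notation B := (sysB S).
Local Notation C := (sysC S).

Definition reachable : {vspace 'cV[F]_n} := limg (linfun (mulmx (ctrb_mx S))).

Definition unobservable : {vspace 'cV[F]_n} := lker (linfun (mulmx (obsv_mx S))).

Lemma reachableP (x : 'cV[F]_n) :
  x \in reachable <->
  exists u : 'I_n -> 'cV[F]_m, x = \sum_(k < n) A ^+ k *m B *m u k.
Proof.
split=> [/memv_imgP [z _ ->] | [u ->]].
  exists (submxcol z); rewrite lfunE /= -{1}(submxcolK z).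
  by rewrite mul_mxrow_mxcol.
apply/memv_imgP; exists (\mxcol_(k < n) u k); first exact: memvf.
by rewrite lfunE /= mul_mxrow_mxcol.
Qed.

Lemma unobservableP (x : 'cV[F]_n) :
  x \in unobservable <-> forall k : 'I_n, C *m A ^+ k *m x = 0.
Proof.
rewrite memv_ker lfunE /= mxcol_mul; split=> [/eqP e k | e].
  by have /mxcolP/(_ k) := etrans e (esym (@mxcol0 _ _ _ _)); rewrite !mxcolK.
by apply/eqP; rewrite -mxcol0; apply: eq_mxcol => k; rewrite e.
Qed.

(** Including the exponent k = n, which the controllability matrix itself does
    not contain, is what gives stability under A; Cayley-Hamilton reduces it to
    the smaller exponents. *)
Lemma reachable_exp (k : nat) (u : 'cV[F]_m) :
  (k <= n)%N -> A ^+ k *m B *m u \in reachable.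
Proof.
have lt_case j (v : 'cV[F]_m) : (j < n)%N -> A ^+ j *m B *m v \in reachable.
  move=> lt_jn; apply/reachableP.
  exists (fun i : 'I_n => if i == Ordinal lt_jn then v else 0).
  rewrite (bigD1 (Ordinal lt_jn)) //= eqxx big1 ?addr0 // => i /negPf ->.
  by rewrite mulmx0.
rewrite leq_eqVlt => /orP[/eqP -> | /lt_case //].
have [c ->] := expmx_dim A.
rewrite !mulmx_suml rpred_sum // => i _.
by rewrite -!scalemxAl rpredZ ?lt_case.
Qed.

(** Counterpart of [reachable_exp] for the observability matrix. *)
Lemma unobservable_exp (k : nat) (x : 'cV[F]_n) :
  x \in unobservable -> (k <= n)%N -> C *m A ^+ k *m x = 0.
Proof.
move=> /unobservableP Hx; rewrite leq_eqVlt => /orP[/eqP -> | lt_kn].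
  have [c ->] := expmx_dim A.
  rewrite mulmx_sumr mulmx_suml big1 // => i _.
  by rewrite -scalemxAr -scalemxAl Hx scaler0.
exact: (Hx (Ordinal lt_kn)).
Qed.

Lemma reachable_input (u : 'cV[F]_m) : B *m u \in reachable.
Proof. by have := reachable_exp u (leq0n n); rewrite expr0 mul1mx. Qed.

Lemma unobservable_output (x : 'cV[F]_n) : x \in unobservable -> C *m x = 0.
Proof. by move=> /unobservable_exp/(_ (leq0n n)); rewrite expr0 mulmx1. Qed.

Lemma reachable_stable (x : 'cV[F]_n) : x \in reachable -> A *m x \in reachable.
Proof.
move=> /reachableP [u ->]; rewrite mulmx_sumr rpred_sum // => k _.
by rewrite !mulmxA mulmxE -exprS reachable_exp.
Qed.

Lemma unobservable_stable (x : 'cV[F]_n) :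
  x \in unobservable -> A *m x \in unobservable.
Proof.
move=> Hx; apply/unobservableP => k.
by rewrite mulmxA -(mulmxA C) mulmxE -exprSr unobservable_exp.
Qed.

(** A subspace that contains the image of B and is stable under A contains every
    A^k B u by induction on k, and these vectors span the reachable subspace. *)
Lemma reachable_min (W : {vspace 'cV[F]_n}) :
  (forall x, x \in W -> A *m x \in W) -> (forall u, B *m u \in W) ->
  (reachable <= W)%VS.
Proof.
move=> WA WB; apply/subvP => x /reachableP [u ->]; apply: rpred_sum => k _.
elim: (k : nat) => [|j IHj]; first by rewrite expr0 mul1mx WB.
by rewrite exprS -mulmxE -!mulmxA WA // mulmxA.
Qed.

(** Stability keeps every A^k x in W, where C vanishes. *)
Lemma unobservable_max (W : {vspace 'cV[F]_n}) :
  (forall x, x \in W -> A *m x \in W) -> (forall x, x \in W -> C *m x = 0) ->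
  (W <= unobservable)%VS.
Proof.
move=> WA WC; apply/subvP => x Wx; apply/unobservableP => k.
rewrite -mulmxA; apply: WC.
elim: (k : nat) => [|j IHj]; first by rewrite expr0 mul1mx.
by rewrite exprS -mulmxE -mulmxA WA.
Qed.

Lemma reachable_full : completely_controllable S <-> reachable = fullv.
Proof.
split=> [rk | full].
  have /mulmxVp inv : row_free (ctrb_mx S) by apply/eqP.
  apply/vspaceP => x; rewrite memvf; apply/memv_imgP.
  exists (pinvmx (ctrb_mx S) *m x); first exact: memvf.
  by rewrite lfunE /= mulmxA inv mul1mx.
(* Row i of the identity, transposed, is a combination of the columns of the
   controllability matrix. *)
rewrite /completely_controllable -mxrank_tr; apply/eqP.
rewrite -[_ == n]/(row_full _) -sub1mx; apply/row_subP => i.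
have : (row i 1%:M)^T \in reachable by rewrite full memvf.
case/memv_imgP=> z _; rewrite lfunE /= => e.
by apply/submxP; exists z^T; rewrite -trmx_mul -e trmxK.
Qed.

Lemma unobservable_eq0 : completely_observable S <-> unobservable = 0%VS.
Proof.
split=> [rk | ker0].
  have /mulVpmx inv : row_full (obsv_mx S) by apply/eqP.
  apply/eqP; rewrite -subv0; apply/subvP => x.
  rewrite memv_ker lfunE /= memv0 => /eqP e.
  by rewrite -[x]mul1mx -inv -mulmxA e mulmx0.
rewrite /completely_observable -mxrank_tr; apply/eqP.
rewrite -[_ == n]/(row_free _) -kermx_eq0; apply/rowV0P => v /sub_kermxP e.
have : v^T \in unobservable.
  by rewrite memv_ker lfunE /= -[obsv_mx S]trmxK -trmx_mul e trmx0.
by rewrite ker0 memv0 => /eqP e0; rewrite -[v]trmxK e0 trmx0.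
Qed.

Definition sys_sub (L : {vspace 'cV[F]_1}) (W : {vspace 'cV[F]_n})
    (v : vertex (sys_quiver m p)) : {vspace 'cV[F]_(sys_dim n v)} :=
  match v with
  | true => W
  | false => L
  end.

Lemma sys_sub_subrep (L : {vspace 'cV[F]_1}) (W : {vspace 'cV[F]_n}) :
  (forall x, x \in W -> A *m x \in W) ->
  (forall i x, x \in L -> col i B *m x \in W) ->
  (forall j x, x \in W -> row j C *m x \in L) ->
  is_subrep (sys_rep S) (sys_sub L W).
Proof. by move=> WA WB WC [[i|j]|[]] x /=; [apply: WB | apply: WC | apply: WA]. Qed.

Lemma vspace_cV1 (L : {vspace 'cV[F]_1}) : L = 0%VS \/ L = fullv.
Proof.
case: (eqVneq L 0%VS) => [|L0]; [by left | right].
apply/eqP; rewrite eqEdim subvf dimvf dim_matrix.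
by rewrite -[(_ <= _)%N]/(0 < \dim L)%N lt0n dimv_eq0.
Qed.

(** Controllability is tested by the subrepresentation with full left component
    and the reachable subspace on the right: being nonzero on the left, it must
    be everything.  Observability is tested by the one with zero left component
    and the unobservable subspace on the right: being proper on the left, it must
    vanish.  Conversely the extremality of these two subspaces leaves no other
    choice for the right component. *)
Lemma canonical_iff_simple : canonical_system S <-> simple_rep (sys_rep S).
Proof.
split=> [[/reachable_full cS /unobservable_eq0 oS] | [_ simS]].
  split; first by exists left_vertex.
  move=> W subW.
  have WA (x : 'cV[F]_n) : x \in W right_vertex -> A *m x \in W right_vertex.
    exact: (subW (inr tt)).
  case: (vspace_cV1 (W left_vertex)) => [L0 | L1]; [left | right].
    have R0 : W right_vertex = 0%VS.
      apply/eqP; rewrite -subv0 -oS; apply: unobservable_max => // x Wx.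
      apply/row_matrixP => j; rewrite row_mul row0.
      apply/eqP; rewrite -memv0 -L0; exact: (subW (inl (inr j)) x Wx).
    by case.
  have R1 : W right_vertex = fullv.
    apply/eqP; rewrite eqEsubv subvf /= -cS; apply: reachable_min => // u.
    (* An arrow b_i acts on the scalar 1 of the full left component by producing
       column i of B, so B u is reached through all the b_i together. *)
    have -> : B *m u = \sum_i u i 0 *: (col i B *m (1%:M : 'M[F]_1)).
      apply/colP => k; rewrite !mxE summxE; apply: eq_bigr => i _.
      by rewrite mulmx1 !mxE mulrC.
    apply: rpred_sum => i _; apply: rpredZ.
    by apply: (subW (inl (inl i))); rewrite L1 memvf.
  by case.
split.
  apply/reachable_full.
  have sub : is_subrep (sys_rep S) (sys_sub fullv reachable).
    apply: sys_sub_subrep => [x|i x _|j x _]; first exact: reachable_stable.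
      by rewrite colE -mulmxA reachable_input.
    exact: memvf.
  case: (simS _ sub) => /= [z | f]; last exact: (f right_vertex).
  by have /eqP := z left_vertex; rewrite /= -dimv_eq0 dimvf dim_matrix.
apply/unobservable_eq0.
have sub : is_subrep (sys_rep S) (sys_sub 0%VS unobservable).
  apply: sys_sub_subrep => [x|i x|j x]; first exact: unobservable_stable.
    by rewrite memv0 => /eqP ->; rewrite mulmx0 mem0v.
  by move=> /unobservable_output e; rewrite -row_mul e row0 mem0v.
case: (simS _ sub) => /= [z | f]; first exact: (z right_vertex).
by have /esym/eqP := f left_vertex; rewrite /= -dimv_eq0 dimvf dim_matrix.
Qed.

End Subspaces.

Theorem lemma1 (R : realType) (m n p : nat) (S : linsys (complex R) m n p) :
  canonical_system S <-> simple_rep (sys_rep S).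
Proof. exact: canonical_iff_simple. Qed.
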